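(* Let $H$ be a non-symmetric $3$-generated numerical semigroup. Then $\operatorname{tr}(H)=\mathcal{C}_H$ if and only if $H=\langle 3, 3a+1, 3a+2\rangle$ for some positive integer $a$.
   Context: A numerical semigroup $H$ is a submonoid of $(\mathbb{N},+)$ (with $0\in\mathbb{N}$) such that $\mathbb{N}\setminus H$ is finite; it is $3$-generated if it is minimally generated by three elements; $\langle n_1,n_2,n_3\rangle$ denotes the submonoid of $\mathbb{N}$ generated by $n_1,n_2,n_3$. $M=H\setminus\{0\}$. The Frobenius number $F(H)$ is the largest integer not in $H$. $H$ is symmetric if for all $x\in\mathbb{Z}$ either $x\in H$ or $F(H)-x\in H$. The set of pseudo-Frobenius numbers is $PF(H)=\{f\in \mathbb{N}\setminus H: f+M\subseteq H\}$. The canonical ideal of $H$ is $\Omega_H=\{-f+h : f\in PF(H),\ h\in H\}\subset\mathbb{Z}$, the anti-canonical ideal is $\Omega_H^{-1}=\{x\in\mathbb{Z}: x+\Omega_H\subseteq H\}$, and the trace of $H$ is $\operatorname{tr}(H)=\Omega_H+\Omega_H^{-1}\subseteq H$. The conductor ideal is $\mathcal{C}_H=\{h\in\mathbb{N}: h>F(H)\}$. *)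

(* Defs.v *)
From mathcomp Require Export all_boot all_order all_algebra.
From mathcomp Require Export boolp classical_sets functions cardinality.

Set Implicit Arguments.
Unset Strict Implicit.
Unset Printing Implicit Defensive.

Import Order.TTheory GRing.Theory Num.Theory.

Local Open Scope classical_set_scope.
Local Open Scope ring_scope.

Definition submonoid (A : set nat) : Prop :=
  A 0%N /\ forall x y : nat, A x -> A y -> A (x + y)%N.

Definition generated (G : set nat) : set nat := smallest submonoid G.

Definition numerical_semigroup (H : set nat) : Prop :=
  submonoid H /\ finite_set (~` H).

Definition minimally_generates (G H : set nat) : Prop :=
  generated G = H /\ forall G' : set nat, G' `<` G -> generated G' <> H.

Definition three_generated (H : set nat) : Prop :=
  exists G : set nat, (G #= `I_3)%card /\ minimally_generates G H.

Definition toZ (A : set nat) : set int := Posz @` A.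

Definition is_frobenius (H : set nat) (f : int) : Prop :=
  ~ toZ H f /\ forall x : int, ~ toZ H x -> x <= f.

(* The default value 0 is never used: when H is a numerical semigroup, the
   integers outside H are nonempty (-1 is one) and bounded above. *)
Definition frobenius (H : set nat) : int := xget 0 [set f | is_frobenius H f].

Definition symmetric_semigroup (H : set nat) : Prop :=
  forall x : int, toZ H x \/ toZ H (frobenius H - x).

Definition pseudo_frobenius (H : set nat) : set nat :=
  [set f | ~ H f /\ forall m : nat, H m -> m <> 0%N -> H (f + m)%N].

Definition canonical_ideal (H : set nat) : set int :=
  [set - f%:Z + h%:Z | f in pseudo_frobenius H & h in H].

Definition anticanonical_ideal (H : set nat) : set int :=
  [set x | forall w : int, canonical_ideal H w -> toZ H (x + w)].

Definition trace_ideal (H : set nat) : set int :=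
  [set w + x | w in canonical_ideal H & x in anticanonical_ideal H].

Definition conductor_ideal (H : set nat) : set int :=
  toZ [set h : nat | frobenius H < h%:Z].

(* Main.v *)
(** Let [H = <n1, n2, n3>] with [n1] the smallest generator, and [F] its
    Frobenius number.  Comparing the factorizations of [f + n1], [f + n2] and
    [f + n3] shows that [H] has at most two pseudo-Frobenius numbers; when [H]
    is not symmetric these are [f < F].  Put [d = F - f].  Then [F + Omega] is
    the union of [H] and [d + H], so [tr(H)] lies in the conductor iff
    [h, h + d \in H] implies [h > F].  Under this condition [f + n1] and
    [F + n1] have disjoint supports, hence, up to exchanging [n2] and [n3],
    [f + n1 = b n2] and [F + n1 = c n3], with no other factorizations.
    Every gap lies below [f] or [F], so [n2 + n3] is a multiple of [n1], and
    then [n2 - d] and [n3 + d] are in [H]; hence [n2, n3 > F] and [b = c = 1].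
    Thus each of the [n1] consecutive integers [F + 1, .., F + n1] is [n2], [n3]
    or a multiple of [n1], which forces [n1 = 3]. *)

Require Import Defs.
From mathcomp Require Import zify.

Set Implicit Arguments.
Unset Strict Implicit.
Unset Printing Implicit Defensive.

Local Open Scope classical_set_scope.

Local Open Scope ring_scope.
Local Open Scope nat_scope.

(** * Submonoids spanned by three numbers *)

Definition span3 (p q r : nat) : set nat :=
  [set n | exists x y z, n = x * p + y * q + z * r].

Lemma span3_swap12 p q r : span3 p q r = span3 q p r.
Proof. by apply/seteqP; split=> n [x [y [z ->]]]; exists y, x, z; lia. Qed.

Lemma span3_swap23 p q r : span3 p q r = span3 p r q.
Proof. by apply/seteqP; split=> n [x [y [z ->]]]; exists x, z, y; lia. Qed.

Lemma submonoid_span3 p q r : submonoid (span3 p q r).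
Proof.
split; first by exists 0, 0, 0.
move=> _ _ [x [y [z ->]]] [x' [y' [z' ->]]].
by exists (x + x'), (y + y'), (z + z'); lia.
Qed.

Lemma submonoidM (A : set nat) k x : submonoid A -> A x -> A (k * x).
Proof.
move=> [A0 AD] Ax; elim: k => [|k IHk]; first by rewrite mul0n.
by rewrite mulSn; apply: AD.
Qed.

Lemma generated3 p q r : generated [set p; q; r] = span3 p q r.
Proof.
apply/seteqP; split=> [n|_ [x [y [z ->]]] A [Asub GA]].
  apply; split; first exact: submonoid_span3.
  move=> _ [[]|] ->; [exists 1, 0, 0|exists 0, 1, 0|exists 0, 0, 1]; lia.
have [_ AD] := Asub.
by do 2?apply: (AD); apply: submonoidM => //; apply: GA;
  [left; left|left; right|right].
Qed.

Lemma generated_setD0 (G : set nat) : generated (G `\ 0) = generated G.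
Proof.
apply/seteqP; split=> n Gn A [Asub GA]; apply: Gn; split=> // x.
  by move=> [/GA].
have [->|/eqP x0] := eqVneq x 0; first by case: Asub.
by move=> Gx; apply: GA.
Qed.

(** Minimality keeps 0 out of the generating set, since removing 0 does not change the generated
    submonoid. The bijection with [I_3] then lists three positive generators, and a smallest one is
    moved to the front. *)
Lemma three_generated_span (H : set nat) : three_generated H ->
  exists p q r, [/\ 0 < p, p <= q, p <= r & H = span3 p q r].
Proof.
move=> [G [cardG [GH Gmin]]].
have G0 : ~ G 0.
  move=> G0; apply: (Gmin (G `\ 0)); last by rewrite generated_setD0.
  by split=> [x []//|/(_ 0 G0) [_ /(_ erefl)]].
have /card_set_bijP[f [fG _ fsurj]] : (`I_3 #= G)%card by rewrite card_eq_sym.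
have Gf i : i < 3 -> 0 < f i.
  by move=> i3; rewrite lt0n; apply/eqP => f0; apply: G0; rewrite -f0; apply: fG.
have HG : H = span3 (f 0) (f 1) (f 2).
  rewrite -generated3 -GH; congr generated; apply/seteqP; split=> x.
    move=> /fsurj [[|[|[|i]]] //= _ <-]; [left; left|left; right|right]; exact: erefl.
  by move=> [[]|] ->; apply: fG.
have [[f0 f1] f2] := (Gf 0 isT, Gf 1 isT, Gf 2 isT).
move: (f 0) (f 1) (f 2) f0 f1 f2 HG => p q r p0 q0 r0 HG.
have [pq|qp] := leqP p q; have [pr|rp] := leqP p r.
- by exists p, q, r; split.
- by exists r, p, q; split; rewrite // ?HG; [lia|lia|rewrite span3_swap23 span3_swap12].
- by exists q, p, r; split; rewrite // ?HG; [lia|lia|rewrite span3_swap12].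
- have [qr|rq] := leqP q r.
    by exists q, p, r; split; rewrite // ?HG; [lia|rewrite span3_swap12].
  exists r, p, q; split; rewrite // ?HG; [lia|lia|].
  by rewrite span3_swap23 span3_swap12.
Qed.

(** * The Frobenius number and the conductor *)

Lemma toZP (H : set nat) (x : nat) : toZ H x%:Z <-> H x.
Proof. by split=> [[y Hy [<-]]|Hx] //; exists x. Qed.

Lemma is_frobenius_unique (H : set nat) (f g : int) :
  is_frobenius H f -> is_frobenius H g -> f = g.
Proof. by move=> [Hf fmax] [Hg gmax]; have := fmax _ Hg; have := gmax _ Hf; lia. Qed.

Lemma finite_set_natP (A : set nat) :
  finite_set A -> exists N, forall n, A n -> n < N.
Proof.
rewrite finite_seqP => -[s ->].
elim: s => [|x s [N IH]]; first by exists 0.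
exists (maxn x.+1 N) => n /=; rewrite inE => /orP[/eqP ->|/IH]; lia.
Qed.

Lemma is_frobenius_frobenius (H : set nat) :
  numerical_semigroup H -> is_frobenius H (frobenius H).
Proof.
move=> [_ /finite_set_natP[N HN]]; apply: (@xgetPex _ _ [set f | is_frobenius H f]).
pose P c := `[< forall n, c <= n -> H n >].
have exP : exists c, P c.
  exists N; apply/asboolP => n Nn; apply: contrapT => /HN; lia.
case: (ex_minnP exP) => c /asboolP Pc cmin.
(* Here [c] is the least bound from which on everything lies in [H]; as an integer, c - 1 also
   covers c = 0, where the Frobenius number is -1. *)
exists (c%:Z - 1)%R; split=> [Hc|x Hx].
  case: c Pc cmin Hc => [|c] Pc cmin; first by move=> [].
  have -> : (c.+1%:Z - 1)%R = c%:Z by lia.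
  move=> /toZP Hc; suff : c < c by lia.
  apply: cmin; apply/asboolP => n; rewrite leq_eqVlt => /orP[/eqP <- //|]; exact: Pc.
case: x Hx => [x|x] Hx; last by lia.
have [cx|] := leqP c x; last by lia.
by case: Hx; apply/toZP/Pc.
Qed.

(** Write n = -F + (n + F). The second summand is anti-canonical because n + F - f >= n > F for
    every gap f. *)
Lemma conductor_subset_trace (H : set nat) (F : nat) :
  submonoid H -> ~ H F -> (forall n, F < n -> H n) ->
  forall n, F < n -> trace_ideal H n%:Z.
Proof.
move=> [H0 _] HF Fmax n Fn.
exists (- F%:Z)%R.
  exists F; first by split=> // m _ m0; apply: Fmax; lia.
  by exists 0 => //; lia.
exists (n + F)%:Z; last by lia.
move=> _ [f [Hf _] [h _ <-]].
have fF : f <= F by rewrite leqNgt; apply/negP => /Fmax.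
by exists (n + F - f + h); [apply: Fmax; lia | lia].
Qed.

(** * Gaps and pseudo-Frobenius numbers *)

Section NatSemigroup.

Variables (H : set nat) (F : nat).
Hypotheses (H_submonoid : submonoid H) (HF : ~ H F).
Hypothesis Fmax : forall n, F < n -> H n.

Let H0 : H 0. Proof. by case: H_submonoid. Qed.
Let HD x y : H x -> H y -> H (x + y). Proof. by case: H_submonoid => _; apply. Qed.

Lemma gap_le_frobenius x : ~ H x -> x <= F.
Proof. by move=> Hx; rewrite leqNgt; apply/negP => /Fmax. Qed.

Lemma pseudo_frobenius_frobenius : pseudo_frobenius H F.
Proof. by split=> // m _ m0; apply: Fmax; lia. Qed.

(** A gap that is not pseudo-Frobenius stays a gap after adding some nonzero element of [H]; this
    climb stops because gaps are bounded by [F]. *)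
Lemma gap_below_pseudo_frobenius x : ~ H x ->
  exists2 p, pseudo_frobenius H p & exists2 h, H h & p = x + h.
Proof.
have [n] := ubnP (F - x); elim: n x => // n IHn x Fxn Hx.
have [PFx|PFx] := pselect (pseudo_frobenius H x).
  by exists x => //; exists 0; rewrite ?addn0.
have [m [Hm m0 Hxm]] : exists m, [/\ H m, m <> 0 & ~ H (x + m)].
  apply: contrapT => nex; apply: PFx; split=> // m Hm m0.
  by apply: contrapT => Hxm; apply: nex; exists m.
have xmF := gap_le_frobenius Hxm.
have lt_n : F - (x + m) < n by lia.
have [p PFp [h Hh p_eq]] := IHn _ lt_n Hxm.
by exists p => //; exists (m + h); [apply: HD | lia].
Qed.

Lemma pseudo_frobenius_diff p q h :
  pseudo_frobenius H p -> pseudo_frobenius H q -> H h -> p = q + h -> p = q.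
Proof.
move=> [Hp _] [_ PFq] Hh pqh; have [h0|/eqP h0] := eqVneq h 0.
  by rewrite pqh h0 addn0.
by case: Hp; rewrite pqh; apply: PFq.
Qed.

End NatSemigroup.

(** * Factorizations over three generators and the bound on the type *)

Section Span3.

Variables n1 n2 n3 : nat.
Local Notation H := (span3 n1 n2 n3).

Lemma span3_1 : H n1. Proof. by exists 1, 0, 0; lia. Qed.
Lemma span3_2 : H n2. Proof. by exists 0, 1, 0; lia. Qed.
Lemma span3_3 : H n3. Proof. by exists 0, 0, 1; lia. Qed.

(** A factorization of f + n1 that used n1 would put f in [H]. The next two lemmas apply this to n2
    and n3. *)
Lemma add_gen1 f : ~ H f -> H (f + n1) -> exists b c, f + n1 = b * n2 + c * n3.
Proof.
move=> Hf [[|a] [b [c e]]]; first by exists b, c; rewrite e.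
by case: Hf; exists a, b, c; move: e; rewrite mulSn; lia.
Qed.

Lemma add_gen2 f : ~ H f -> H (f + n2) -> exists a c, f + n2 = a * n1 + c * n3.
Proof.
move=> Hf [a [[|b] [c e]]]; first by exists a, c; rewrite e; lia.
by case: Hf; exists a, b, c; move: e; rewrite mulSn; lia.
Qed.

Lemma add_gen3 f : ~ H f -> H (f + n3) -> exists a b, f + n3 = a * n1 + b * n2.
Proof.
move=> Hf [a [b [[|c] e]]]; first by exists a, b; rewrite e; lia.
by case: Hf; exists a, b, c; move: e; rewrite mulSn; lia.
Qed.

(** If one pair of coefficients dominated the other, the two pseudo-Frobenius numbers would differ
    by an element of [H], hence coincide. *)
Lemma factorization_antichain p q b c b' c' :
    pseudo_frobenius H p -> pseudo_frobenius H q -> p <> q ->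
    p + n1 = b * n2 + c * n3 -> q + n1 = b' * n2 + c' * n3 ->
  (b < b' /\ c' < c) \/ (b' < b /\ c < c').
Proof.
move=> PFp PFq pq ep eq.
have sub f g x y x' y' : pseudo_frobenius H f -> pseudo_frobenius H g -> f <> g ->
    f + n1 = x * n2 + y * n3 -> g + n1 = x' * n2 + y' * n3 ->
    ~ (x <= x' /\ y <= y').
  move=> PFf PFg fg ef eg [xx' yy']; apply: fg; apply/esym.
  apply: (@pseudo_frobenius_diff H g f ((x' - x) * n2 + (y' - y) * n3)) => //.
    by exists 0, (x' - x), (y' - y); lia.
  move: ef eg; rewrite -{1}(subnKC xx') -{1}(subnKC yy') !mulnDl; lia.
have := sub _ _ _ _ _ _ PFp PFq pq ep eq.
have := sub _ _ _ _ _ _ PFq PFp (fun e => pq (esym e)) eq ep; lia.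
Qed.

(* For [p = f], [q = F] this says [n2 - d \in H], and after exchanging [n2] and
   [n3], for [p = F], [q = f], it says [n3 + d \in H]. *)
Lemma shift_gen2 p q b c k :
    0 < n1 -> ~ H p -> ~ H q -> H (p + n2) ->
    p + n1 = b * n2 -> q + n1 = c * n3 ->
    (forall x y z, c * n3 = x * n1 + y * n2 + z * n3 -> y = 0) ->
    (forall x y z, b * n2 = x * n1 + y * n2 + z * n3 -> z = 0) ->
    n2 + n3 = k * n1 ->
  exists2 h, H h & n2 + p = q + h.
Proof.
move=> n1_gt0 Hp Hq Hp2 ep eq only3 only2 ek.
have [x [z e2]] := add_gen2 Hp Hp2.
(* If z >= c, then c n3 = q + n1 can be split off from p + n2. Otherwise adding n1 + n3 to both
   sides and cancelling n1 gives a factorization excluded by [only2] or [only3]. *)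
have [cz|zc] := leqP c z.
  by exists ((x + 1) * n1 + (z - c) * n3); [exists (x + 1), 0, (z - c)|]; nia.
have e : b * n2 + k * n1 = (x + 1) * n1 + (z + 1) * n3 by nia.
have [kx|xk] := leqP k (x + 1).
  by have := only2 (x + 1 - k) 0 (z + 1); nia.
by have := only3 (k - (x + 1)) b (c - (z + 1)); nia.
Qed.

Hypotheses (n1_gt0 : 0 < n1) (n2_gt0 : 0 < n2) (n3_gt0 : 0 < n3).

(** Taking the least coefficient of n3 settles the case in [middle_pseudo_frobenius] where n2 and n3
    are traded without any n1. *)
Definition min_factorization (f b c : nat) : Prop :=
  f + n1 = b * n2 + c * n3 /\
  forall b' c', f + n1 = b' * n2 + c' * n3 -> c <= c'.

Lemma exists_min_factorization f :
  pseudo_frobenius H f -> exists b c, min_factorization f b c.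
Proof.
move=> [Hf PFf].
have [|b [c e]] := add_gen1 Hf; first by apply: PFf; [exact: span3_1|lia].
pose P c := `[< exists b, f + n1 = b * n2 + c * n3 >].
have exP : exists c, P c by exists c; apply/asboolP; exists b.
case: (ex_minnP exP) => c' /asboolP[b' e'] c'min.
by exists b', c'; split=> // b'' c'' e''; apply: c'min; apply/asboolP; exists b''.
Qed.

(* [q] is between [p] and [r] in the antichain of factorizations; since
   [p, r \notin H], the factorizations of [q + n2] and [q + n3] involve so few
   [n3] and [n2] that they can be traded inside that of [q + n1]. *)
Lemma middle_pseudo_frobenius p q r bp cp bq cq br cr :
    pseudo_frobenius H p -> pseudo_frobenius H q -> pseudo_frobenius H r ->
    min_factorization p bp cp -> min_factorization q bq cq ->
    min_factorization r br cr ->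
  bp < bq -> bq < br -> cr < cq -> cq < cp -> False.
Proof.
move=> [Hp _] [Hq PFq] [Hr _] [ep _] [eq qmin] [er _] bpq bqr crq cqp.
have [|a [c1 e2]] := add_gen2 Hq; first by apply: PFq; [exact: span3_2|lia].
have [|a' [b1 e3]] := add_gen3 Hq; first by apply: PFq; [exact: span3_3|lia].
have c1_lt : c1 < cq.
  rewrite ltnNge; apply/negP => c1_ge; apply: Hr.
  by exists a, (br - bq - 1), (c1 - (cq - cr)); nia.
have b1_lt : b1 < bq.
  rewrite ltnNge; apply/negP => b1_ge; apply: Hp.
  by exists a', (b1 - (bq - bp)), (cp - cq - 1); nia.
(* Comparing [e2] and [e3] gives a n1 + (c1 + 1) n3 = a' n1 + (b1 + 1) n2. Trading along this
   relation in q + n1 frees a copy of n1, so that q lies in [H], unless a = a', when it lowers the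
   coefficient of n3. *)
have [aa'|a'a|aa'] := ltngtP a a'.
- by apply: Hq; exists (a' - a - 1), (bq + b1 + 1), (cq - c1 - 1); nia.
- by apply: Hq; exists (a - a' - 1), (bq - b1 - 1), (cq + c1 + 1); nia.
- have := qmin (bq + b1 + 1) (cq - c1 - 1); nia.
Qed.

(** Three distinct pseudo-Frobenius numbers would give three pairwise incomparable factorizations;
    sorted by the coefficient of n2, one of them is in the middle. *)
Lemma type_le2 p q r :
    pseudo_frobenius H p -> pseudo_frobenius H q -> pseudo_frobenius H r ->
  p <> q -> p <> r -> q = r.
Proof.
move=> PFp PFq PFr pq pr; apply: contrapT => qr.
have [bp [cp mp]] := exists_min_factorization PFp.
have [bq [cq mq]] := exists_min_factorization PFq.
have [br [cr mr]] := exists_min_factorization PFr.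
have middle := middle_pseudo_frobenius.
case: (factorization_antichain PFp PFq pq (proj1 mp) (proj1 mq)) => -[? ?];
case: (factorization_antichain PFp PFr pr (proj1 mp) (proj1 mr)) => -[? ?];
case: (factorization_antichain PFq PFr qr (proj1 mq) (proj1 mr)) => -[? ?];
  try lia.
- exact: (middle _ _ _ _ _ _ _ _ _ PFp PFq PFr mp mq mr).
- exact: (middle _ _ _ _ _ _ _ _ _ PFp PFr PFq mp mr mq).
- exact: (middle _ _ _ _ _ _ _ _ _ PFr PFp PFq mr mp mq).
- exact: (middle _ _ _ _ _ _ _ _ _ PFq PFp PFr mq mp mr).
- exact: (middle _ _ _ _ _ _ _ _ _ PFq PFr PFp mq mr mp).
- exact: (middle _ _ _ _ _ _ _ _ _ PFr PFq PFp mr mq mp).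
Qed.

End Span3.

(** * Consequences of the trace lying in the conductor *)

(* This expresses [tr(H) \subset C_H] when [PF(H) = {f, F}]. *)
Definition trace_condition (H : set nat) (f F : nat) : Prop :=
  forall h, H h -> H (h + (F - f)) -> F < h.

(** Write h = -F + (h + F): adding h + F sends the generators -F and -f of the canonical ideal to h
    and h + (F - f), so h is in the trace. *)
Lemma trace_conditionP (H : set nat) (f F : nat) :
    pseudo_frobenius H f -> f < F ->
    (forall p, pseudo_frobenius H p -> p = f \/ p = F) -> submonoid H ->
    pseudo_frobenius H F -> frobenius H = F%:Z ->
  trace_ideal H `<=` conductor_ideal H -> trace_condition H f F.
Proof.
move=> PFf fF PFle [H0 HD] PFF frobH sub h Hh Hhd.
have [|y] := sub h%:Z; last by rewrite /= frobH; lia.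
exists (- F%:Z)%R; first by exists F => //; exists 0 => //; lia.
exists (h + F)%:Z; last by lia.
move=> _ [p PFp [g Hg <-]].
case: (PFle _ PFp) => ->.
  by exists (h + (F - f) + g); [exact: HD | lia].
by exists (h + g); [exact: HD | lia].
Qed.

Lemma trace_condition_corner (n1 n2 n3 f F b c : nat) (H := span3 n1 n2 n3) :
    0 < n1 -> n1 <= n2 -> n1 <= n3 ->
    pseudo_frobenius H f -> pseudo_frobenius H F -> f < F ->
    (forall n, F < n -> H n) ->
    (forall x, ~ H x ->
      (exists2 h, H h & f = x + h) \/ (exists2 h, H h & F = x + h)) ->
    trace_condition H f F ->
    f + n1 = b * n2 -> F + n1 = c * n3 ->
  exists2 a, 0 < a & [/\ n1 = 3, n2 = 3 * a + 1 & n3 = 3 * a + 2].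
Proof.
move=> n1_gt0 n12 n13 [Hf PFf] [HF PFF] fF Fmax gap T ef eF.
have Hn1 : H n1 by exact: span3_1.
have Hn2 : H n2 by exact: span3_2.
have Hn3 : H n3 by exact: span3_3.
have d_lt : F < f + n1.
  apply: T; first by apply: PFf => //; lia.
  have -> : f + n1 + (F - f) = F + n1 by lia.
  by apply: PFF => //; lia.
have b_gt0 : 0 < b by rewrite lt0n; apply/eqP => b0; subst b; lia.
have c_gt0 : 0 < c by rewrite lt0n; apply/eqP => c0; subst c; lia.
(* Otherwise n3 could be removed from both f + n1 and F + n1, leaving elements of [H] that differ by
   F - f, the smaller being at most f. *)
have only2 x y z : b * n2 = x * n1 + y * n2 + z * n3 -> z = 0.
  case: z => [//|z] e; suff : F < f + n1 - n3 by lia.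
  apply: T; first by exists x, y, z; lia.
  by exists 0, 0, (c - 1); nia.
have only3 x y z : c * n3 = x * n1 + y * n2 + z * n3 -> y = 0.
  case: y => [//|y] e; suff : F < f + n1 - n2 by lia.
  apply: T; first by exists 0, (b - 1), 0; nia.
  by exists x, y, z; nia.
(* If n2 + n3 - n1 were a gap, f + n1 or F + n1 would have a factorization using both n2 and n3.
   Once it is in [H], a factorization of it using n2 or n3 would put F or f in [H]. *)
have [k ek] : exists k, n2 + n3 = k * n1.
  have [x [y [z e]]] : H (n2 + n3 - n1).
    apply: contrapT => /gap [] [_ [x [y [z ->]]] e].
      by have := only2 x y.+1 z.+1; lia.
    by have := only3 x y.+1 z.+1; lia.
  case: y e => [|y] e; last first.
    by case: HF; exists x, y, (z + (c - 1)); nia.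
  case: z e => [|z] e; last first.
    by case: Hf; exists x, (b - 1), z; nia.
  by exists x.+1; lia.
have F_lt2 : F < n2.
  have Hf2 : H (f + n2) by apply: PFf => //; lia.
  have [h Hh eh] := shift_gen2 n1_gt0 Hf HF Hf2 ef eF only3 only2 ek.
  suff : F < h by lia.
  by apply: T => //; have -> : h + (F - f) = n2 by lia.
have F_lt3 : F < n3.
  have HF3 : H (F + n3) by apply: PFF => //; lia.
  have [h Hh eh] : exists2 h, H h & n3 + F = f + h.
    move: Hf HF HF3; rewrite /H span3_swap23 => Hf HF HF3.
    apply: (shift_gen2 n1_gt0 HF Hf HF3 eF ef (k := k)); last by lia.
      by move=> x y z e; apply: (only2 x z y); lia.
    by move=> x y z e; apply: (only3 x z y); lia.
  by apply: T => //; have -> : n3 + (F - f) = h by lia.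
(* Both n2 and n3 exceed F and are at least n1, so twice either of them exceeds F + n1. *)
have c1 : c = 1 by nia.
have b1 : b = 1 by nia.
subst b c; rewrite !mul1n in ef eF.
have window x : F < x -> x < n3 -> x <> n2 -> exists i, x = i * n1.
  move=> Fx xn3 xn2; have [i [j [l e]]] := Fmax x Fx.
  have l0 : l = 0 by case: l e => [//|l]; rewrite mulSn; lia.
  have j0 : j = 0.
    case: j e => [//|[|j]]; rewrite ?mulSn; last by lia.
    by case: i => [|i]; rewrite ?mulSn; lia.
  by exists i; subst j l; lia.
(* If n1 >= 4, two of F + 1, F + 2, F + 3 differ from n2 and lie below n3 = F + n1; they would be
   distinct multiples of n1 less than n1 apart. *)
have n1_lt4 : n1 < 4.
  rewrite ltnNge; apply/negP => n1_ge4.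
  have clash x y : F < x -> x < y -> y < n3 -> x <> n2 -> y <> n2 -> False.
    move=> Fx xy yn3 x2 y2.
    have [|i ei] := window x Fx _ x2; first lia.
    have [|j ej] := window y _ yn3 y2; first lia.
    have ij : i < j by rewrite -(ltn_pmul2r n1_gt0) -ei -ej.
    by have := leq_mul ij (leqnn n1); rewrite mulSn -ei -ej; lia.
  have := clash (F + 1) (F + 2); have := clash (F + 1) (F + 3).
  by have := clash (F + 2) (F + 3); lia.
have nf i : f <> i * n1 by move=> e; apply: Hf; exists i, 0, 0; lia.
have nF i : F <> i * n1 by move=> e; apply: HF; exists i, 0, 0; lia.
have [e1|[e1|e1]] : n1 = 1 \/ n1 = 2 \/ n1 = 3 by lia.
- by have := nf f; lia.
- by have := nf (f %/ 2); have := nF (F %/ 2); lia.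
have := nf (f %/ 3); have := nF (F %/ 3) => nF3 nf3.
have [fmod|fmod] : f %% 3 = 1 \/ f %% 3 = 2 by lia.
  by exists (n2 %/ 3); [lia | split; lia].
(* In this case f + 1 is a multiple of 3, so F = f + 2, and f + 1 and f + 3 = n2 are elements of [H]
   that differ by F - f. *)
suff : F < f + 1 by lia.
apply: T; first by exists ((f + 1) %/ 3), 0, 0; lia.
by have -> : f + 1 + (F - f) = n2 by lia.
Qed.

(** A generator common to f + n1 and F + n1 could be removed from both, against the trace condition.
    So each is a multiple of a single generator, which is the situation of [trace_condition_corner]
    up to exchanging n2 and n3. *)
Lemma trace_condition_span3 (n1 n2 n3 f F : nat) (H := span3 n1 n2 n3) :
    0 < n1 -> n1 <= n2 -> n1 <= n3 ->
    pseudo_frobenius H f -> pseudo_frobenius H F -> f < F ->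
    (forall n, F < n -> H n) ->
    (forall x, ~ H x ->
      (exists2 h, H h & f = x + h) \/ (exists2 h, H h & F = x + h)) ->
    trace_condition H f F ->
  exists2 a, 0 < a & H = span3 3 (3 * a + 1) (3 * a + 2).
Proof.
move=> n1_gt0 n12 n13 PFf PFF fF Fmax gap T.
have [[Hf PFfD] [HF PFFD]] := (PFf, PFF).
have Hfn : H (f + n1) by apply: PFfD; [exact: span3_1 | lia].
have HFn : H (F + n1) by apply: PFFD; [exact: span3_1 | lia].
have [b [c ef]] := add_gen1 Hf Hfn.
have [b' [c' eF]] := add_gen1 HF HFn.
have disj2 : b = 0 \/ b' = 0.
  case: b ef => [|b] ef; [by left | case: b' eF => [|b'] eF; [by right|]].
  suff : F < f + n1 - n2 by lia.
  by apply: T; [exists 0, b, c | exists 0, b', c']; lia.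
have disj3 : c = 0 \/ c' = 0.
  case: c ef => [|c] ef; [by left | case: c' eF => [|c'] eF; [by right|]].
  suff : F < f + n1 - n3 by lia.
  by apply: T; [exists 0, b, c | exists 0, b', c']; lia.
have [c0|c_gt0] := posnP c.
  have b'0 : b' = 0 by case: disj2 => // b0; subst b c; lia.
  have [||a a_gt0 [e1 e2 e3]] := trace_condition_corner
    n1_gt0 n12 n13 PFf PFF fF Fmax gap T (b := b) (c := c').
  - by subst c; lia.
  - by subst b'; lia.
  by exists a; rewrite // /H e1 e2 e3.
have c'0 : c' = 0 by case: disj3 => // c0; lia.
have b0 : b = 0 by case: disj2 => // b'0; subst b' c'; lia.
move: PFf PFF Fmax gap T; rewrite /H span3_swap23 => PFf PFF Fmax gap T.
have [||a a_gt0 [e1 e2 e3]] := trace_condition_corner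
  n1_gt0 n13 n12 PFf PFF fF Fmax gap T (b := c) (c := b').
- by subst b; lia.
- by subst c'; lia.
by exists a; rewrite // e1 e2 e3.
Qed.

(** * A second pseudo-Frobenius number from non-symmetry *)

(** Take x with neither x nor F - x in [H], and a pseudo-Frobenius number f = x + h with h in [H].
    If f were F, then F - x = h would lie in [H]. *)
Lemma nonsymmetric_pseudo_frobenius (H : set nat) :
    numerical_semigroup H -> ~ symmetric_semigroup H ->
  exists f F : nat, [/\ frobenius H = F%:Z, pseudo_frobenius H f,
    pseudo_frobenius H F, f < F & forall n, F < n -> H n].
Proof.
move=> H_semigroup H_nonsym; have [Hsub _] := H_semigroup.
have [HF Fmax] := is_frobenius_frobenius H_semigroup.
have [x Hx HFx] : exists2 x : int, ~ toZ H x & ~ toZ H (frobenius H - x)%R.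
  apply: contrapT => nex; apply: H_nonsym => x.
  have [|Hx] := pselect (toZ H x); [by left | right].
  by apply: contrapT => HFx; apply: nex; exists x.
have xF := Fmax _ Hx; have := Fmax _ HFx => Fx.
case: x Hx HFx xF Fx => [x|x]; last by lia.
case: (frobenius H) HF Fmax => [F|F] HF Fmax Hx HFx xF Fx; last by lia.
have HF' : ~ H F by move=> /toZP.
have Fmax' n : F < n -> H n.
  by move=> Fn; apply: contrapT => Hn; have := Fmax n%:Z; rewrite toZP => /(_ Hn); lia.
have Hx' : ~ H x by move=> /toZP.
have [f PFf [h Hh fxh]] := gap_below_pseudo_frobenius Hsub Fmax' Hx'.
have PFF := pseudo_frobenius_frobenius HF' Fmax'.
exists f, F; split=> //.
have := gap_le_frobenius Fmax' (proj1 PFf); rewrite leq_eqVlt => /orP[/eqP fF|//].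
by case: HFx; exists h => //; lia.
Qed.

(** * The trace for the generators 3, 3a + 1, 3a + 2 *)

Lemma mem_span3_family a n :
  span3 3 (3 * a + 1) (3 * a + 2) n <-> n %% 3 = 0 \/ 3 * a <= n.
Proof.
split=> [[x [y [z ->]]]|n_in].
  by case: y => [|y]; [case: z => [|z]|]; [left; lia|right; lia|right; lia].
have [n0|[n1|n2]] : n %% 3 = 0 \/ n %% 3 = 1 \/ n %% 3 = 2 by lia.
- by exists (n %/ 3), 0, 0; lia.
- by exists ((n - (3 * a + 1)) %/ 3), 1, 0; lia.
- by exists ((n - (3 * a + 2)) %/ 3), 0, 1; lia.
Qed.

Lemma is_frobenius_family a : 0 < a ->
  is_frobenius (span3 3 (3 * a + 1) (3 * a + 2)) (3 * a - 1)%N%:Z.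
Proof.
move=> a_gt0; split=> [/toZP/mem_span3_family|[x|x] Hx]; [lia| |lia].
rewrite lez_nat leqNgt; apply/negP => x_gt.
by apply/Hx/toZP/mem_span3_family; lia.
Qed.

(** Both 3a - 1 and 3a - 2 are pseudo-Frobenius, so an anti-canonical x yields consecutive elements
    u = x - (3a - 1) and u + 1 of [H], which forces u >= 3a. *)
Lemma trace_family_subset a (H := span3 3 (3 * a + 1) (3 * a + 2)) :
  0 < a -> trace_ideal H `<=` toZ [set n | 3 * a <= n].
Proof.
move=> a_gt0 _ [_ [f [Hf _] [h Hh <-]] [x Hx <-]].
have f_lt : f < 3 * a.
  by rewrite ltnNge; apply/negP => f_ge; apply: Hf; apply/mem_span3_family; right.
have PF i : i = 3 * a - 1 \/ i = 3 * a - 2 -> canonical_ideal H (- i%:Z)%R.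
  move=> ei; exists i; last by exists 0; [exists 0, 0, 0 | lia].
  split=> [/mem_span3_family|m /mem_span3_family Hm m0]; first lia.
  by apply/mem_span3_family; lia.
have [u /mem_span3_family Hu eu] := Hx _ (PF _ (or_introl erefl)).
have [v /mem_span3_family Hv ev] := Hx _ (PF _ (or_intror erefl)).
by exists (u + h + (3 * a - 1 - f)) => /=; lia.
Qed.

Theorem proposition2p5 (H : set nat)
    (H_semigroup : numerical_semigroup H)
    (H_3gen : three_generated H)
    (H_nonsym : ~ symmetric_semigroup H) :
  trace_ideal H = conductor_ideal H <->
  exists a : nat, (0 < a)%N /\
    H = generated [set 3%N; (3 * a + 1)%N; (3 * a + 2)%N].
Proof.
have [Hsub _] := H_semigroup.
have [f [F [frobH PFf PFF fF Fmax]]] :=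
  nonsymmetric_pseudo_frobenius H_semigroup H_nonsym.
split=> [trH|[a [a_gt0]]].
  have [n1 [n2 [n3 [n1_gt0 n12 n13 HE]]]] := three_generated_span H_3gen.
  have PF2 p : pseudo_frobenius H p -> p = f \/ p = F.
    move=> PFp; have [->|pf] := pselect (p = f); [by left | right].
    subst H; apply/esym.
    by apply: (type_le2 _ _ _ PFf PFF PFp); lia.
  have T : trace_condition H f F by apply: trace_conditionP; rewrite // trH.
  have gap x : ~ H x ->
      (exists2 h, H h & f = x + h) \/ (exists2 h, H h & F = x + h).
    move=> /(gap_below_pseudo_frobenius Hsub Fmax)[p PFp hp].
    by case: (PF2 p PFp) => <-; [left | right].
  subst H.
  have [a a_gt0 ->] := trace_condition_span3 n1_gt0 n12 n13 PFf PFF fF Fmax gap T.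
  by exists a; rewrite generated3.
rewrite generated3 => HE.
have F_eq : F = 3 * a - 1.
  have := is_frobenius_frobenius H_semigroup; rewrite frobH {1}HE => HF.
  by have := is_frobenius_unique HF (is_frobenius_family a_gt0); lia.
apply/seteqP; split=> [x|_ [n /= n_gt <-]].
  rewrite HE => /(trace_family_subset a_gt0)[n /= n_ge <-].
  by exists n => //=; rewrite -HE frobH; lia.
by apply: conductor_subset_trace (proj1 PFF) Fmax _ _ => //; rewrite frobH in n_gt; lia.
Qed.
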